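(* Let $n\ge 1$ and let $R=(r_1,\dots,r_n)$ and $S=(s_1,\dots,s_n)$ be vectors of nonnegative real numbers with $\sum_i r_i=\sum_j s_j$. Then $\mathcal{T}^{+1}(R,S)\neq\emptyset$ if and only if $S=R^r$, where $R^r=(r_n,\dots,r_2,r_1)$ is the reversal of $R$. Likewise, if $R$ and $S$ have nonnegative integer components, then $\mathcal{T}^{+1}_{\mathbb{Z}}(R,S)\neq\emptyset$ if and only if $S=R^r$.
   Context: $\mathcal{T}(R,S)$ is the set of $n\times n$ matrices with nonnegative real entries whose $i$th row sum is $r_i$ and whose $j$th column sum is $s_j$ for all $i,j$. The reflection $r_{+1}$ (in the line of slope $+1$) acts on $n\times n$ matrices as transposition with respect to the antidiagonal: $(r_{+1}A)_{i,j}=a_{n+1-j,\,n+1-i}$. $\mathcal{T}^{+1}(R,S)$ is the set of $A\in\mathcal{T}(R,S)$ with $r_{+1}A=A$; $\mathcal{T}^{+1}_{\mathbb{Z}}(R,S)$ is the set of those $A\in\mathcal{T}^{+1}(R,S)$ all of whose entries are integers. *)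

(* Defs.v *)
From mathcomp Require Import all_boot all_order all_algebra.
From mathcomp Require Import classical_sets reals.

Set Implicit Arguments.
Unset Strict Implicit.
Unset Printing Implicit Defensive.

Import Order.TTheory GRing.Theory Num.Theory.
Local Open Scope classical_set_scope.
Local Open Scope ring_scope.

(* Indices range over 'I_n = {0, ..., n-1}, so the reversal k |-> n + 1 - k of
   {1, ..., n} is rev_ord, whose value at i is n - 1 - i. *)

Definition rev_row (K : realType) (n : nat) (R : 'rV[K]_n) : 'rV[K]_n :=
  \row_(j < n) R ord0 (rev_ord j).

Definition antitrmx (K : realType) (n : nat) (A : 'M[K]_n) : 'M[K]_n :=
  \matrix_(i < n, j < n) A (rev_ord j) (rev_ord i).

Definition transport (K : realType) (n : nat) (R S : 'rV[K]_n) :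
    set 'M[K]_n :=
  [set A | [/\ forall i j, 0 <= A i j,
               forall i, \sum_(j < n) A i j = R ord0 i &
               forall j, \sum_(i < n) A i j = S ord0 j]].

Definition transport_anti (K : realType) (n : nat) (R S : 'rV[K]_n) :
    set 'M[K]_n :=
  [set A | transport R S A /\ antitrmx A = A].

Definition transport_anti_int (K : realType) (n : nat) (R S : 'rV[K]_n) :
    set 'M[K]_n :=
  [set A | transport_anti R S A /\ forall i j, A i j \is a Num.int].

(* Main.v *)
(* Reflecting in the antidiagonal exchanges column j with row n + 1 - j, which
   forces S = R^r; conversely, the matrix with R on the antidiagonal and zeros
   elsewhere is a witness, integral when R is. *)

Require Import Defs.
From mathcomp Require Import all_boot all_order all_algebra.
From mathcomp Require Import classical_sets reals.

Set Implicit Arguments.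
Unset Strict Implicit.
Unset Printing Implicit Defensive.

Import Order.TTheory GRing.Theory Num.Theory.
Local Open Scope classical_set_scope.
Local Open Scope ring_scope.

Definition antidiag_mx (K : realType) (n : nat) (R : 'rV[K]_n) : 'M[K]_n :=
  \matrix_(i < n, j < n) (if j == rev_ord i then R ord0 i else 0).

Lemma antidiag_mx_transport_anti (K : realType) (n : nat) (R : 'rV[K]_n) :
  (forall i, 0 <= R ord0 i) ->
  transport_anti R (rev_row R) (antidiag_mx R).
Proof.
move=> hR; split; [split|].
- by move=> i j; rewrite mxE; case: ifP.
- by move=> i; under eq_bigr do rewrite mxE; rewrite -big_mkcond big_pred1_eq.
- move=> j; rewrite mxE; under eq_bigr do rewrite mxE.
  (* As [rev_ord] is an involution, column [j] meets the antidiagonal only in row [rev_ord j]. *)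
  rewrite -big_mkcond (big_pred1 (rev_ord j)) // => i.
  by rewrite -(inj_eq rev_ord_inj) rev_ordK eq_sym.
(* The reflection fixes each antidiagonal position and permutes the others, where the entries
   vanish. *)
- apply/matrixP => i j; rewrite !mxE rev_ordK.
  by have [->|] := eqVneq j (rev_ord i); rewrite ?rev_ordK ?eqxx // eq_sym => /negPf->.
Qed.

Lemma transport_anti_rev_row (K : realType) (n : nat) (R S : 'rV[K]_n) A :
  transport_anti R S A -> S = rev_row R.
Proof.
move=> [[_ rowA colA] symA]; apply/rowP => j; rewrite mxE -colA -rowA.
(* By symmetry, column [j] is row [rev_ord j] read backwards; reversing the row sum matches the two
   term by term. *)
rewrite [RHS](reindex_inj rev_ord_inj); apply: eq_bigr => i _.
by rewrite -[in LHS]symA mxE.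
Qed.

Theorem theorem4 (K : realType) (n : nat) (hn : (1 <= n)%N)
    (R S : 'rV[K]_n)
    (hR : forall i, 0 <= R ord0 i) (hS : forall j, 0 <= S ord0 j)
    (hRS : \sum_(i < n) R ord0 i = \sum_(j < n) S ord0 j) :
  (transport_anti R S !=set0 <-> S = rev_row R) /\
  ((forall i, R ord0 i \is a Num.int) ->
   (forall j, S ord0 j \is a Num.int) ->
   (transport_anti_int R S !=set0 <-> S = rev_row R)).
Proof.
split=> [|intR intS]; split.
- by move=> [A /transport_anti_rev_row].
- by move=> ->; exists (antidiag_mx R); exact: antidiag_mx_transport_anti.
- by move=> [A [/transport_anti_rev_row]].
- move=> ->; exists (antidiag_mx R); split.
    exact: antidiag_mx_transport_anti.
  (* An antidiagonal entry is integral by [intR]; every other entry is 0. *)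
  by move=> i j; rewrite mxE; case: ifP => // _; exact: rpred0.
Qed.
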